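(* Suppose that $q\in[1,\infty)$, and that $b$ and $c$ are positive constants such that $R_0/(1-\beta)<c<b$. Then $BMO_b^q(\mu)$ and $BMO_c^q(\mu)$ coincide and the norms $N_b^q$ and $N_c^q$ are equivalent.
   Context: Setting. $(M,\rho,\mu)$ is a metric measure space ($\mu$ a Borel measure), $M$ is unbounded, $\mu(M)>0$ and every ball has finite measure. $\mathcal{B}$ is the family of all balls of $M$; $c_B$, $r_B$ are the centre and radius of $B\in\mathcal{B}$, $\kappa B$ is the ball with centre $c_B$ and radius $\kappa r_B$; for $b>0$, $\mathcal{B}_b$ is the family of balls with $r_B\le b$. For $A\subset M$ and $\kappa>0$, $A_\kappa=\{x\in A:\rho(x,A^c)\le\kappa\}$. It is assumed that $M$ has the following three properties. Local doubling property (LDP): for every $b>0$ there is a constant $D_b$ such that $\mu(2B)\le D_b\,\mu(B)$ for all $B\in\mathcal{B}_b$. Isoperimetric property (I): there exist $\kappa_0,C>0$ such that for every bounded open set $A$, $\mu(A_\kappa)\ge C\kappa\,\mu(A)$ for all $\kappa\in(0,\kappa_0]$. Approximate midpoint property (AMP): there exist $R_0\in[0,\infty)$ and $\beta\in(1/2,1)$ such that for every pair of points $x,y\in M$ with $\rho(x,y)>R_0$ there is a ball $B$ containing $x$ and $y$ with $r_B<\beta\,\rho(x,y)$. The constants $R_0,\beta$ are fixed. BMO. For $q\in[1,\infty)$, $b>0$ and a locally integrable function $f$ put $N_b^q(f)=\sup_{B\in\mathcal{B}_b}\bigl(\frac1{\mu(B)}\int_B|f-f_B|^q\,d\mu\bigr)^{1/q}$,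 where $f_B$ is the average of $f$ over $B$. $BMO_b^q(\mu)$ is the space of equivalence classes modulo constants of locally integrable $f$ with $N_b^q(f)<\infty$, with norm $N_b^q$. *)

(* Defs.v *)
From HB Require Import structures.
From mathcomp Require Import all_boot all_order all_algebra.
From mathcomp Require Import all_classical all_reals all_analysis.

Set Implicit Arguments.
Unset Strict Implicit.
Unset Printing Implicit Defensive.

Import Order.TTheory GRing.Theory Num.Theory.
Import numFieldNormedType.Exports.

Local Open Scope classical_set_scope.
Local Open Scope ring_scope.

(* A ball is handled as a pair (centre, radius) with radius > 0, so that c_B,
   r_B and kappa B make sense although different pairs may give the same set.
   Balls are open: [ball x r] is [set y | mdist x y < r]. *)

#[short(type="measurableMetricType")]
HB.structure Definition MeasurableMetric d (R : realType) :=
  { M of Metric R M & Measurable d M }.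

Section metric_notions.
Context {R : realType} (M : metricType R).

Definition metric_bounded (A : set M) := exists x r, A `<=` ball x r.

(* If ~` A is empty the distance is +oo and the layer is empty. *)
Definition inner_layer (A : set M) (kappa : R) : set M :=
  [set x | A x /\ (edist_inf (~` A) x <= kappa%:E)%E].

Definition approximate_midpoint (R0 beta : R) := forall x y : M,
  R0 < mdist x y ->
  exists z r, [/\ 0 < r, r < beta * mdist x y, ball z r x & ball z r y].

End metric_notions.

Section metric_measure_notions.
Context {d : measure_display} {R : realType} {M : measurableMetricType d R}.
Variable mu : {measure set M -> \bar R}.

Definition locally_doubling := forall b : R, 0 < b ->
  exists D : R, forall (x : M) (r : R), 0 < r -> r <= b ->
    (mu (ball x (2 * r)) <= D%:E * mu (ball x r))%E.

Definition isoperimetric := exists kappa0 C : R, [/\ 0 < kappa0, 0 < C &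
  forall A : set M, open A -> metric_bounded A ->
  forall kappa : R, 0 < kappa -> kappa <= kappa0 ->
    ((C * kappa)%:E * mu A <= mu (inner_layer A kappa))%E].

(* Integrability on every ball is what gives a meaning to all the averages;
   M is not assumed to be locally compact. *)
Definition ball_integrable (f : M -> R) :=
  forall (x : M) (r : R), 0 < r -> mu.-integrable (ball x r) (EFin \o f).

Definition average (f : M -> R) (B : set M) : R :=
  (fine (mu B))^-1 * (\int[mu]_(y in B) f y).

Definition small_balls (b : R) : set (set M) :=
  [set B | exists x r, [/\ 0 < r, r <= b & B = ball x r]].

Definition oscillation (q : R) (f : M -> R) (B : set M) : \bar R :=
  (((mu B)^-1 * \int[mu]_(x in B) (`|f x - average f B| `^ q)%:E) `^ q^-1)%E.

Definition BMO_norm (q b : R) (f : M -> R) : \bar R :=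
  ereal_sup [set oscillation q f B | B in small_balls b].

Definition class_mod_constants (f : M -> R) : set (M -> R) :=
  [set g | ball_integrable g /\
           exists k : R, {ae mu, forall x, g x = f x + k}].

Definition BMO (q b : R) : set (set (M -> R)) :=
  [set class_mod_constants f | f in
    [set f | ball_integrable f /\ (BMO_norm q b f < +oo)%E]].

End metric_measure_notions.

(* Main.v *)
(* Since beta > 1/2, the hypothesis R0 / (1 - beta) < c gives R0 <= c / 2. Put
   s = c / 2. Centres at distance at most s have comparable averages over their
   balls of radius s, since both balls lie in a common ball of radius c and LDP
   applies. Bisecting repeatedly with AMP joins any two points at distance at
   most b by a chain of boundedly many such steps, so the averages over balls of
   radius s centred at such points differ by at most a constant times N_c(f).
   Finally LDP bounds the size of an s-separated subset of a ball of radius at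
   most b, so this ball is covered by boundedly many balls of radius s and the
   oscillations on the latter add up. *)

Require Import Defs.
From HB Require Import structures.
From mathcomp Require Import all_boot all_order all_algebra.
From mathcomp Require Import all_classical all_reals all_analysis.
From mathcomp Require Import measurable_realfun ring lra.

Import Order.TTheory GRing.Theory Num.Theory.
Import numFieldNormedType.Exports.

Local Open Scope classical_set_scope.
Local Open Scope ring_scope.

(** * Elementary inequalities for real powers *)

Lemma powR_ge1 (R : realType) (a x : R) : 1 <= a -> 0 <= x -> 1 <= a `^ x.
Proof. by move=> a1 x0; rewrite -(powRr0 a) ler_powR. Qed.

(* With u = |f - a|, this bounds the mean of u by its q-mean and so replaces
   Hoelder's inequality, at the cost of a constant. *)
Lemma le_addpowR (R : realType) (q t u : R) : 1 <= q -> 0 < t -> 0 <= u ->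
  u <= t + t * (t `^ q)^-1 * u `^ q.
Proof.
move=> q1 t0 u0; have tq : 0 < t `^ q by exact: powR_gt0.
have [ut|tu] := leP u t.
  rewrite (le_trans ut)// lerDl mulr_ge0 ?powR_ge0// mulr_ge0 ?invr_ge0 ?ltW//.
have uE : u = t * (u / t) by rewrite mulrC divfK// gt_eqF.
have ut1 : 1 <= u / t by rewrite ler_pdivlMr// mul1r ltW.
move: (u / t) uE ut1 => v -> v1; have v0 : 0 <= v by rewrite (le_trans _ v1).
rewrite powRM ?(ltW t0)// [t / _ * _]mulrA divfK ?gt_eqF//.
apply: (@le_trans _ _ (t * v `^ q)); last by rewrite lerDr ltW.
by rewrite ler_wpM2l ?(ltW t0)// le1r_powR.
Qed.

(** The sum is at most twice the larger term. This crude bound takes the place of convexity. *)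
Lemma powRD_le (R : realType) (q u v : R) : 0 <= q -> 0 <= u -> 0 <= v ->
  (u + v) `^ q <= 2 `^ q * (u `^ q + v `^ q).
Proof.
move=> q0 u0 v0.
wlog uv : u v u0 v0 / u <= v.
  move=> H; have [|/ltW] := leP u v; first exact: H.
  by rewrite [u + v]addrC [u `^ q + _]addrC; exact: H.
apply: (@le_trans _ _ ((2 * v) `^ q)).
  by rewrite ge0_ler_powR ?nnegrE ?addr_ge0 ?mulr_ge0// mulr_natl mulr2n lerD2r.
by rewrite powRM// ler_wpM2l ?powR_ge0// lerDr powR_ge0.
Qed.

(** * Integrals of powers of the oscillation over a fixed set *)

Section mean_oscillation.
Context {d : measure_display} {T : measurableType d} {R : realType}.
Variable mu : {measure set T -> \bar R}.

(** Passes from a large ball to a finite cover by small balls, which may overlap. *)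
Lemma integral_bigsetU_le (I : Type) (l : seq I) (A : set T) (F : I -> set T)
    (g : T -> \bar R) :
  measurable A -> (forall i, measurable (F i)) ->
  (forall x, 0 <= g x)%E -> (forall i, measurable_fun (F i) g) ->
  A `<=` \big[setU/set0]_(i <- l) F i ->
  (\int[mu]_(x in A) g x <= \sum_(i <- l) \int[mu]_(x in F i) g x)%E.
Proof.
move=> mA mF g0 mg AF.
have mU : forall l, measurable (\big[setU/set0]_(i <- l) F i).
  by move=> l'; apply: bigsetU_measurable.
have mgU : forall l, measurable_fun (\big[setU/set0]_(i <- l) F i) g.
  elim=> [|i l' IH]; first by rewrite big_nil; exact: measurable_fun_set0.
  by rewrite big_cons; apply/measurable_funU => //; split => //.
apply: (@le_trans _ _ (\int[mu]_(x in \big[setU/set0]_(i <- l) F i) g x)%E).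
  by apply: ge0_subset_integral.
elim: l {AF} => [|i l IH]; first by rewrite !big_nil integral_set0.
(* The union is made disjoint, as [F i] and the remaining sets minus [F i], so that additivity of
   the integral applies. *)
rewrite !big_cons -(setDUK (@subsetUl _ (F i) (\big[setU/set0]_(j <- l) F j))).
rewrite setDUl setDv set0U.
have mD := measurableD (mU l) (mF i).
rewrite ge0_integral_setU//.
- apply: leeD => //; apply: le_trans IH.
  by apply: ge0_subset_integral => //; exact: subDsetl.
- apply/measurable_funU => //; split => //.
  by apply: measurable_funS (mgU l) => //; exact: subDsetl.
- by rewrite disj_set_sym; apply/disj_setPS => x [[_ ?]].
Qed.

Section one_set.
Variables (E : set T) (f : T -> R) (a q t H : R).
Hypotheses (mE : measurable E) (E0 : (0 < mu E)%E) (Efin : (mu E < +oo)%E).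
Hypothesis (intf : mu.-integrable E (EFin \o f)).
Hypotheses (q1 : 1 <= q) (t0 : 0 < t) (H0 : 0 <= H).
Hypothesis (osc : (\int[mu]_(x in E) (`|f x - a| `^ q)%:E <=
  (H * t `^ q)%:E * mu E)%E).

Lemma measurable_oscillation_integrand b :
  measurable_fun E (fun x => (`|f x - b| `^ q)%:E).
Proof.
apply/measurable_EFinP.
apply: (measurableT_comp (measurable_powR q)).
apply: measurableT_comp => //.
apply: measurable_funB => //.
by have /integrableP[/measurable_EFinP] := intf.
Qed.

(** The difference is the average of [f - a]. Integrating [le_addpowR] with [u = |f - a|] bounds the
    integral of [u] by [t * mu E] plus [t / t^q] times the integral in [osc], that is by
    [(1 + H) * t * mu E]. *)
Lemma average_dist_le :
  `|(fine (mu E))^-1 * (\int[mu]_(x in E) f x) - a| <= (1 + H) * t.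
Proof.
have mf : mu E \is a fin_num by rewrite ge0_fin_numE.
have m0 : 0 < fine (mu E) by rewrite fine_gt0// E0.
have tq : 0 < t `^ q by exact: powR_gt0.
have inta : mu.-integrable E (EFin \o cst a).
  apply/integrableP; split; first exact/measurable_EFinP/measurable_cst.
  rewrite (eq_integral (cst `|a|%:E))//.
  by rewrite integral_cst// -(fineK mf) -EFinM ltry.
have -> : (fine (mu E))^-1 * (\int[mu]_(x in E) f x) - a =
   (fine (mu E))^-1 * (\int[mu]_(x in E) (f x - a)).
  rewrite RintegralB// Rintegral_cst// mulrBr mulrCA mulVf ?mulr1//.
  by rewrite gt_eqF.
have intfa : mu.-integrable E (EFin \o (fun x => f x - a)).
  rewrite (_ : _ \o _ = (EFin \o f) \- (EFin \o cst a))%E; last exact/funext.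
  exact: integrableB.
rewrite normrM normfV (gtr0_norm m0) mulrC ler_pdivrMr//.
apply: le_trans (le_normr_Rintegral _ intfa) _ => //.
have intn : mu.-integrable E (EFin \o (fun x => `|f x - a|)).
  exact: (integrable_norm intfa).
rewrite -lee_fin /Rintegral fineK; last exact: integrable_fin_num.
rewrite EFinM fineK//.
have mn : measurable_fun E (EFin \o (fun x => `|f x - a|)).
  by have /integrableP[] := intn.
pose k := t * (t `^ q)^-1.
have k0 : 0 <= k by rewrite mulr_ge0 ?invr_ge0// ltW.
have mo := measurable_oscillation_integrand a.
have mko : measurable_fun E (fun x => (k%:E * (`|f x - a| `^ q)%:E)%E).
  exact: measurable_funeM.
apply: (@le_trans _ _ (\int[mu]_(x in E) (cst t%:E x + k%:E * (`|f x - a| `^ q)%:E)%E)%E).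
  apply: ge0_le_integral => //.
  - by apply: emeasurable_funD => //; exact: measurable_cst.
  by move=> x _; rewrite -EFinM -EFinD lee_fin le_addpowR.
rewrite ge0_integralD//; last 2 first.
- by move=> x _; rewrite lee_fin ltW.
- by move=> x _; rewrite lee_fin mulr_ge0// powR_ge0.
rewrite integral_cst// ge0_integralZl//.
rewrite mulrDl mul1r EFinD muleDl ?ge0_adde_def ?inE ?lee_fin ?(ltW t0)//; last first.
  by rewrite mulr_ge0// ltW.
apply: leeD => //.
apply: (@le_trans _ _ (k%:E * ((H * t `^ q)%:E * mu E))%E).
  by rewrite lee_wpmul2l// lee_fin.
rewrite muleA -EFinM /k (_ : t / _ * _ = H * t)//.
by field; rewrite gt_eqF.
Qed.

(** Write [f - b = (f - a) + (a - b)] and apply [powRD_le] pointwise; the constant term contributes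
    at most [(K * t)^q * mu E]. *)
Lemma integral_recenter_le (b K : R) : 0 <= K -> `|a - b| <= K * t ->
  (\int[mu]_(x in E) (`|f x - b| `^ q)%:E <=
  (2 `^ q * (H + K `^ q) * t `^ q)%:E * mu E)%E.
Proof.
move=> K0 ab.
have q0 : 0 <= q by rewrite (le_trans _ q1).
apply: (@le_trans _ _ (\int[mu]_(x in E)
  ((2 `^ q)%:E * ((`|f x - a| `^ q)%:E + cst ((K * t) `^ q)%:E x))%E)%E).
  apply: ge0_le_integral => //.
  - exact: measurable_oscillation_integrand.
  - apply: measurable_funeM.
    apply: (@emeasurable_funD _ _ _ E _ (cst ((K * t) `^ q)%:E)) => //.
    exact: measurable_oscillation_integrand.
  move=> x _; rewrite -EFinD -EFinM lee_fin.
  apply: (le_trans _ (powRD_le _ _ _ _ _ _ _)) => //; last by rewrite mulr_ge0// ltW.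
  rewrite ge0_ler_powR ?nnegrE ?addr_ge0 ?mulr_ge0 ?(ltW t0)//.
  rewrite (_ : f x - b = (f x - a) + (a - b)); last by rewrite addrA subrK.
  by rewrite (le_trans (ler_normD _ _))// lerD2l.
have mo := measurable_oscillation_integrand a.
rewrite ge0_integralZl//; last 2 first.
- exact: (@emeasurable_funD _ _ _ E _ (cst ((K * t) `^ q)%:E)).
- by move=> x _; rewrite lee_fin addr_ge0 ?powR_ge0.
rewrite ge0_integralD//.
rewrite integral_cst// -mulrA EFinM -muleA lee_wpmul2l ?lee_fin ?powR_ge0//.
rewrite mulrDl EFinD muleDl//.
- by rewrite powRM ?(ltW t0)//; apply: leeD.
- by rewrite ge0_fin_numE.
- by move=> x _; rewrite lee_fin powR_ge0.
Qed.

End one_set.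
End mean_oscillation.

(** * Balls, separated sets and chains in a metric space *)

Section metric_lemmas.
Context {R : realType} {M : metricType R}.

Lemma ball_mdistE (x y : M) r : ball x r y = (mdist x y < r) :> Prop.
Proof. by rewrite ballEmdist. Qed.

Lemma subset_ball_mdist (x y : M) r r' : mdist x y + r <= r' ->
  ball y r `<=` ball x r'.
Proof.
move=> h z; rewrite !ball_mdistE => yz.
by rewrite (le_lt_trans (metric_triangle x y z))// (lt_le_trans _ h)// ltrD2l.
Qed.

Lemma open_ball_mdist (x : M) r : open (ball x r).
Proof.
rewrite openE => y; rewrite ball_mdistE => xy.
apply/nbhs_ballP; exists (r - mdist x y); first by rewrite /= subr_gt0.
by apply: subset_ball_mdist; rewrite addrC subrK.
Qed.

(** Greedy selection: either some point of [E] is at distance at least [s] from all points chosen so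
    far and is added, or the list is already an [s]-net. Excluding long separated lists thus yields
    a short net. *)
Lemma separated_or_net (E : set M) (s : R) (n : nat) :
  (exists l : seq M, [/\ size l = n, (forall x, x \in l -> E x) &
     pairwise (fun x y => s <= mdist x y) l]) \/
  (exists l : seq M, [/\ (size l < n)%N, (forall x, x \in l -> E x) &
     forall y, E y -> exists2 x, x \in l & mdist x y < s]).
Proof.
elim: n => [|n IH]; first by left; exists [::].
case: IH => [[l [sl lE lsep]]|[l [sl lE lnet]]]; last first.
  by right; exists l; split => //; rewrite ltnS ltnW.
have [[y [Ey yl]]|noy] := pselect (exists y, E y /\
    all (fun x => s <= mdist y x) l).
  left; exists (y :: l); split.
  - by rewrite /= sl.
  - by move=> x; rewrite inE => /orP[/eqP->//|/lE].
  - by rewrite pairwise_cons yl lsep.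
right; exists l; split => //; first by rewrite sl.
move=> y Ey; apply: contrapT => nox; apply: noy; exists y; split => //.
apply/allP => x xl; rewrite leNgt; apply/negP => yx; apply: nox.
by exists x => //; rewrite metric_sym.
Qed.

(** The centre [z] of an AMP ball is closer than [beta * mdist x y] to both points, so each
    bisection doubles the number of links and shrinks them by the factor [beta]. After [n]
    bisections there are at most [2^n] links of length at most [delta]. *)
Lemma approximate_midpoint_chain (phi : M -> R) (R0 beta delta K : R) :
  approximate_midpoint M R0 beta -> R0 <= delta -> 0 < beta ->
  (forall x y, mdist x y <= delta -> `|phi x - phi y| <= K) ->
  forall n x y, mdist x y * beta ^+ n <= delta ->
    `|phi x - phi y| <= 2 ^+ n * K.
Proof.
move=> amp R0d b0 phiK; elim=> [|n IH] x y.
  by rewrite expr0 mulr1 mul1r; exact: phiK.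
(* AMP is silent up to distance [R0], but there [R0 <= delta] makes the pair a single link; [K] is
   nonnegative because it bounds an absolute value. *)
have [xyR0 _|R0xy xyn] := leP (mdist x y) R0.
  have xyd := phiK _ _ (le_trans xyR0 R0d).
  rewrite (le_trans xyd)// ler_peMl ?exprn_ege1 ?ler1n//.
  exact: le_trans (normr_ge0 _) xyd.
have [z [r [_ rxy]]] := amp x y R0xy.
rewrite !ball_mdistE => zx zy.
have near_z u : mdist z u < r -> mdist z u * beta ^+ n <= delta.
  move=> zu; apply: le_trans xyn; rewrite exprS mulrA.
  rewrite ler_pM2r ?exprn_gt0// ltW// (lt_trans zu)//.
  by rewrite [mdist x y * _]mulrC.
rewrite (_ : phi x - phi y = (phi z - phi y) - (phi z - phi x)); last by ring.
rewrite (le_trans (ler_normB _ _))// exprS -mulrA mulr_natl mulr2n.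
by apply: lerD; apply: IH; exact: near_z.
Qed.

End metric_lemmas.

(** * Finite sums of uniformly bounded terms *)

Section seq_esum.
Context {R : realType} {I : eqType}.
Local Open Scope ereal_scope.

Lemma le_sume_seq_cst (l : seq I) (g : I -> \bar R) (u : R) :
  (forall i, i \in l -> g i <= u%:E) ->
  \sum_(i <- l) g i <= ((size l)%:R * u)%R%:E.
Proof.
elim: l => [|i l IH] h; first by rewrite big_nil mul0r.
rewrite big_cons /= mulrSr mulrDl mul1r EFinD addeC; apply: leeD.
  by apply: h; rewrite mem_head.
by apply: IH => j jl; apply: h; rewrite inE jl orbT.
Qed.

Lemma ge_sume_seq_cst (l : seq I) (g : I -> \bar R) (u : R) :
  (forall i, i \in l -> u%:E <= g i) ->
  ((size l)%:R * u)%R%:E <= \sum_(i <- l) g i.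
Proof.
elim: l => [|i l IH] h; first by rewrite big_nil mul0r.
rewrite big_cons /= mulrSr mulrDl mul1r EFinD addeC; apply: leeD.
  by apply: h; rewrite mem_head.
by apply: IH => j jl; apply: h; rewrite inE jl orbT.
Qed.

End seq_esum.

(** * Consequences of local doubling for the measure of balls *)

Section metric_measure.
Context {d : measure_display} {R : realType} {M : measurableMetricType d R}.
Variable mu : {measure set M -> \bar R}.
Hypothesis borel_M : @measurable d M = <<s @open M >>.

Lemma measurable_ball_mdist (x : M) r : measurable (ball x r : set M).
Proof. by rewrite borel_M; apply: sub_sigma_algebra; exact: open_ball_mdist. Qed.

(** By the triangle inequality the open balls are pairwise disjoint. *)
Lemma measure_separated_balls (l : seq M) (rho : R) :
  pairwise (fun x y => 2 * rho <= mdist x y) l ->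
  (mu (\big[setU/set0]_(x <- l) ball x rho) =
   \sum_(x <- l) mu (ball x rho))%E.
Proof.
elim: l => [|x l IH]; first by rewrite !big_nil measure0.
rewrite pairwise_cons => /andP[/allP xl lsep].
rewrite !big_cons measureU; first by congr (_ + _)%E; exact: IH.
- exact: measurable_ball_mdist.
- by apply: bigsetU_measurable => y _; exact: measurable_ball_mdist.
apply/seteqP; split => // z [xz]; rewrite -bigcup_seq => -[y /= yl yz].
move: xz yz; rewrite !ball_mdistE => xz yz.
have := le_lt_trans (metric_triangle x z y) (ltrD xz _).
rewrite [mdist z y]metric_sym => /(_ _ yz).
by rewrite -mulr2n -mulr_natl ltNge xl.
Qed.

Hypothesis LDP : locally_doubling mu.

Lemma iter_doubling (n : nat) (s : R) : 0 < s -> exists2 A : R, 0 <= A &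
  forall x : M, (mu (ball x (2 ^+ n * s)) <= A%:E * mu (ball x s))%E.
Proof.
move=> s0; elim: n => [|n [A A0 IH]].
  by exists 1 => // x; rewrite expr0 mul1r mul1e.
have r0 : 0 < 2 ^+ n * s by rewrite mulr_gt0// exprn_gt0.
have [D hD] := LDP _ r0.
(* The constant from LDP carries no sign; its positive part keeps the products monotone. *)
exists (Num.max D 0 * A); first by rewrite mulr_ge0// le_max lexx orbT.
move=> x; rewrite exprS -mulrA.
apply: (le_trans (hD _ _ r0 (lexx _))).
apply: (@le_trans _ _ ((Num.max D 0)%:E * mu (ball x (2 ^+ n * s)))%E).
  by rewrite lee_wpmul2r// lee_fin le_max lexx.
by rewrite EFinM -muleA lee_wpmul2l// lee_fin le_max lexx orbT.
Qed.

(** [ball x L] lies in [ball y (2 * L)], whose radius is exceeded after finitely many doublings of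
    [s]; their number depends on [L / s] alone. *)
Lemma ball_comparison (L s : R) : 0 < L -> 0 < s -> exists2 A : R, 0 <= A &
  forall x y : M, mdist x y <= L ->
    (mu (ball x L) <= A%:E * mu (ball y s))%E.
Proof.
move=> L0 s0.
pose n := Num.Def.archi_bound (2 * L / s).
have Ln : 2 * L < 2 ^+ n * s by rewrite -ltr_pdivrMr// upper_nthrootP.
have [A A0 hA] := iter_doubling n _ s0.
exists A => // x y xy; apply: le_trans (hA y).
apply: le_measure; rewrite ?inE; try exact: measurable_ball_mdist.
apply: subset_ball_mdist; rewrite metric_sym (le_trans _ (ltW Ln))//.
by rewrite mulr_natl mulr2n lerD2r.
Qed.

Hypothesis mu_pos : (0 < mu [set: M])%E.

(** If a ball were null, doubling would make all balls of radius [2^n * r] about [x] null, and these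
    exhaust [M]. *)
Lemma ball_measure_gt0 (x : M) (r : R) : 0 < r -> (0 < mu (ball x r))%E.
Proof.
move=> r0; rewrite lt_neqAle measure_ge0 andbT; apply/negP => /eqP mu0.
move: mu_pos; rewrite (_ : mu setT = 0%E) ?ltxx//.
have mB n : measurable (ball x (2 ^+ n * r) : set M).
  exact: measurable_ball_mdist.
have neg n : mu.-negligible (ball x (2 ^+ n * r)).
  apply/negligibleP => //; apply/eqP; rewrite eq_le measure_ge0 andbT.
  have [A A0 /(_ x)] := iter_doubling n _ r0.
  by rewrite -mu0 mule0.
apply/(@negligibleP _ _ _ mu setT) => //.
apply: negligibleS (negligible_bigcup neg) => y _.
exists (Num.Def.archi_bound (mdist x y / r)) => //.
by rewrite ball_mdistE -ltr_pdivrMr// upper_nthrootP.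
Qed.

(** * Oscillations over balls and the comparison of two scales *)

Hypothesis mu_ball_fin :
  forall (x : M) (r : R), 0 < r -> (mu (ball x r) < +oo)%E.

(** Balls have positive finite measure, so the root and the division can be cleared. The equality
    form allows rewriting in both directions. *)
Lemma le_oscillation (q t : R) (f : M -> R) (x : M) (r : R) :
  0 < q -> 0 <= t -> 0 < r ->
  (oscillation mu q f (ball x r) <= t%:E)%E =
  (\int[mu]_(y in ball x r) (`|f y - average mu f (ball x r)| `^ q)%:E <=
   (t `^ q)%:E * mu (ball x r))%E.
Proof.
move=> q0 t0 r0; rewrite /oscillation.
set I := (\int[mu]_(_ in _) _)%E.
have I0 : (0 <= I)%E by apply: integral_ge0 => y _; rewrite lee_fin powR_ge0.
have m0 := ball_measure_gt0 x r r0.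
have mf : mu (ball x r) \is a fin_num by rewrite ge0_fin_numE// mu_ball_fin.
have fm0 : 0 < fine (mu (ball x r)) by rewrite fine_gt0// m0 mu_ball_fin.
rewrite -[in LHS](fineK mf) -[in RHS](fineK mf) inver gt_eqF//.
rewrite [in RHS]muleC -lee_pdivrMl//.
set J := (_ * I)%E.
have J0 : (0 <= J)%E by rewrite mule_ge0// lee_fin invr_ge0 ltW.
apply/idP/idP => [h|h].
  have -> : J = ((J `^ q^-1) `^ q)%E.
    by rewrite -poweRrM mulVf ?gt_eqF// poweRe1.
  rewrite -poweR_EFin; apply: gt0_ler_poweR => //; rewrite ?ltW//.
  - by rewrite in_itv/= poweR_ge0 leey.
  - by rewrite in_itv/= lee_fin t0 leey.
have -> : t%:E = ((t `^ q)%:E `^ q^-1)%E.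
  by rewrite poweR_EFin -powRrM mulfV ?gt_eqF// powRr1.
apply: gt0_ler_poweR => //.
- by rewrite invr_ge0 ltW.
- by rewrite in_itv/= J0 leey.
- by rewrite in_itv/= lee_fin powR_ge0 leey.
Qed.

(** The smaller ball lies in [ball x c], so the oscillation integral over the latter dominates;
    [muA] converts its measure, and [average_dist_le] applies with [H = A]. *)
Lemma average_concentric_le (q c A t : R) (f : M -> R) (x y : M) :
  1 <= q -> 0 < c -> 0 <= A -> 0 < t -> ball_integrable mu f ->
  (mu (ball x c) <= A%:E * mu (ball y (c / 2)))%E ->
  (oscillation mu q f (ball x c) <= t%:E)%E ->
  mdist x y <= c / 2 ->
  `|average mu f (ball y (c / 2)) - average mu f (ball x c)| <= (1 + A) * t.
Proof.
move=> q1 c0 A0 t0 intf muA osc xy.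
have q0 : 0 < q by rewrite (lt_le_trans _ q1).
have c20 : 0 < c / 2 by rewrite divr_gt0.
apply: (@average_dist_le _ _ _ mu (ball y (c / 2)) f _ q) => //.
- exact: measurable_ball_mdist.
- exact: ball_measure_gt0.
- exact: mu_ball_fin.
- exact: intf.
move: osc; rewrite le_oscillation ?(ltW t0)// => osc.
apply: (@le_trans _ _ ((t `^ q)%:E * mu (ball x c))%E).
  apply: le_trans osc; apply: ge0_subset_integral.
  - exact: measurable_ball_mdist.
  - exact: measurable_ball_mdist.
  - by apply: measurable_oscillation_integrand; exact: intf.
  - by move=> z _; rewrite lee_fin powR_ge0.
  by apply: subset_ball_mdist; lra.
rewrite mulrC EFinM -muleA.
by rewrite lee_wpmul2l// lee_fin powR_ge0.
Qed.

(** Stated with a positive bound [t] for the norm at scale [c], since [average_dist_le] divides by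
    [t^q] and the norm itself may vanish. *)
Lemma BMO_norm_le_scale (R0 beta q b c : R) :
  approximate_midpoint M R0 beta -> 0 < beta -> beta < 1 -> 1 <= q ->
  0 < c -> c < b -> R0 <= c / 2 ->
  exists2 C : R, 0 < C & forall f, ball_integrable mu f ->
    forall t : R, 0 < t -> (BMO_norm mu q c f <= t%:E)%E ->
      (BMO_norm mu q b f <= (C * t)%:E)%E.
Proof.
move=> amp beta0 beta1 q1 c0 cb R0c.
have q0 : 0 < q by rewrite (lt_le_trans _ q1).
have b0 : 0 < b by rewrite (lt_trans c0).
pose s := c / 2; have s0 : 0 < s by rewrite divr_gt0.
have sc : s < c by rewrite /s; lra.
(* One constant serves every comparison below: all balls involved fit between radii [s / 2] and
   [2 * b]. *)
have [A A0 hA] : exists2 A : R, 0 <= A & forall x y : M, mdist x y <= 2 * b ->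
    (mu (ball x (2 * b)) <= A%:E * mu (ball y (s / 2)))%E.
  by apply: ball_comparison; rewrite ?mulr_gt0 ?divr_gt0.
have ball_le (x y : M) r r' : mdist x y + r <= r' ->
    (mu (ball y r) <= mu (ball x r'))%E.
  move=> h; apply: le_measure; rewrite ?inE; try exact: measurable_ball_mdist.
  exact: subset_ball_mdist.
have [n hn] : exists n, b * beta ^+ n <= s.
  have : beta ^+ n @[n --> \oo] --> 0 by apply: cvg_expr; rewrite gtr0_norm.
  move=> /cvgrPdist_le /(_ (s / b)); rewrite divr_gt0// => /(_ isT) [n _ /(_ n)].
  rewrite /= leqnn sub0r normrN ger0_norm ?exprn_ge0 ?(ltW beta0)// => /(_ isT).
  by rewrite ler_pdivlMr// mulrC; exists n.
pose N := Num.Def.archi_bound A.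
have AN : A < N%:R by exact: archi_boundP.
(* [K]: [2^n] links, each costing two uses of [average_concentric_le]. [G]: recentring on one small
   ball. [H]: at most [N] small balls, each of measure at most [A * mu B]. [H']: final recentring at
   the average over the large ball. *)
pose K := 2 ^+ n * (2 * (1 + A)).
pose G := 2 `^ q * (1 + K `^ q).
pose H := N%:R * G * A.
pose H' := 2 `^ q * (H + (1 + H) `^ q).
have K0 : 0 <= K by rewrite mulr_ge0 ?exprn_ge0// mulr_ge0// addr_ge0.
have G0 : 0 <= G by rewrite mulr_ge0 ?addr_ge0 ?powR_ge0.
have H0 : 0 <= H by rewrite mulr_ge0// mulr_ge0.
have H'0 : 0 < H'.
  rewrite mulr_gt0 ?powR_gt0// ltr_wpDl// powR_gt0// ltr_pwDl//.
exists (H' `^ q^-1); first exact: powR_gt0.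
move=> f intf t t0 /ereal_supP hosc.
have osc x r : 0 < r -> r <= c -> (oscillation mu q f (ball x r) <= t%:E)%E.
  by move=> r0 rc; apply: hosc; exists (ball x r) => //; exists x, r.
have avg_chain x y : mdist x y <= b ->
    `|average mu f (ball x s) - average mu f (ball y s)| <= K * t.
  move=> xyb; rewrite /K -mulrA.
  apply: (approximate_midpoint_chain (fun z => average mu f (ball z s)) _ _ _ _ amp R0c) => //.
    move=> u v uv.
    (* The averages over [ball u s] and [ball v s] are both compared with the one over [ball u c],
       which contains these balls. *)
    have comp z : mdist u z <= s -> 
      `|average mu f (ball z s) - average mu f (ball u c)| <= (1 + A) * t.
      move=> uz; apply: (@average_concentric_le q) => //; last exact: osc.
      apply: le_trans (ball_le u u c (2 * b) _) _; first by rewrite mdistxx; lra.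
      apply: le_trans (hA u z _) _; first by lra.
      rewrite lee_wpmul2l ?lee_fin//; apply: ball_le; rewrite mdistxx add0r /s; lra.
    have hu : `|average mu f (ball u s) - average mu f (ball u c)| <= (1 + A) * t.
      by apply: comp; rewrite mdistxx ltW.
    have hv := comp v uv.
    rewrite (_ : _ - _ = (average mu f (ball u s) - average mu f (ball u c)) -
      (average mu f (ball v s) - average mu f (ball u c))); last by ring.
    rewrite (le_trans (ler_normB _ _))// -mulrA mulr_natl mulr2n.
    exact: lerD.
  by rewrite (le_trans _ hn)// ler_wpM2r// exprn_ge0// ltW.
apply/ereal_supP => _ [_ [x0 [r [r0 rb ->]]] <-].
(* For [r <= c] it is enough that the constant is at least 1, which holds because [2^q] and
   [(1 + H)^q] are. *)
have [rc|cr] := leP r c.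
  apply: (le_trans (osc _ _ r0 rc)).
  rewrite lee_fin ler_peMl ?(ltW t0)//.
  apply: powR_ge1; last by rewrite invr_ge0 ltW.
  apply: mulr_ege1; first by apply: powR_ge1; rewrite ?ler1n ?(ltW q0).
  by apply: ler_wpDl => //; apply: powR_ge1; rewrite ?lerDl ?(ltW q0).
rewrite le_oscillation ?mulr_ge0 ?powR_ge0 ?(ltW t0)//.
rewrite powRM ?powR_ge0 ?(ltW t0)// -powRrM mulVf ?gt_eqF// powRr1 ?(ltW H'0)//.
set B := ball x0 r.
have mB : measurable B by exact: measurable_ball_mdist.
have B0 : (0 < mu B)%E by exact: ball_measure_gt0.
have Bfin : (mu B < +oo)%E by exact: mu_ball_fin.
set a := average mu f (ball x0 s).
(* Chains reach [a], an average at scale [s]. The average over [B] is then within [(1 + H) * t] of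
   [a], and recentring gives [H']. *)
suff oscB : (\int[mu]_(y in B) (`|f y - a| `^ q)%:E <= (H * t `^ q)%:E * mu B)%E.
  apply: (integral_recenter_le mu B f a) => //; first exact: intf.
    by rewrite addr_ge0.
  rewrite distrC; apply: (average_dist_le mu B f a q) => //.
  exact: intf.
pose m := fine (mu (ball x0 (2 * b))).
have b20 : 0 < 2 * b by rewrite mulr_gt0.
have muE : mu (ball x0 (2 * b)) = m%:E.
  by rewrite fineK// ge0_fin_numE// mu_ball_fin.
have m0 : 0 < m by rewrite -lte_fin -muE ball_measure_gt0.
have : exists l : seq M, [/\ (size l < N)%N, (forall x, x \in l -> B x) &
    forall y, B y -> exists2 x, x \in l & mdist x y < s].
  have [[l [sl lB lsep]]|//] := separated_or_net B s N.
  (* The balls of radius [s / 2] about [N] separated points of [B] are disjoint, lie in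
     [ball x0 (2 * b)] and have measure at least [m / A] each; since [N > A], the total would exceed
     [m]. *)
  exfalso.
  have lsep' : pairwise (fun x y : M => 2 * (s / 2) <= mdist x y) l.
    by rewrite mulrC divfK.
  have := measure_separated_balls l (s / 2) lsep'.
  apply/eqP; rewrite lt_eqF//.
  apply: (@le_lt_trans _ _ m%:E).
    rewrite -muE; apply: le_measure; rewrite ?inE.
    - by apply: bigsetU_measurable => y _; exact: measurable_ball_mdist.
    - exact: measurable_ball_mdist.
    rewrite -bigcup_seq => z [y /= /lB]; rewrite /B ball_mdistE => x0y.
    by apply: subset_ball_mdist; rewrite /s; lra.
  have Apos : 0 < A.
    rewrite lt_neqAle A0 andbT; apply/eqP => A00.
    have := hA x0 x0; rewrite mdistxx -A00 mul0e muE => /(_ (ltW b20)).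
    by rewrite lee_fin leNgt m0.
  apply: (@lt_le_trans _ _ ((size l)%:R * (A^-1 * m))%:E).
    by rewrite lte_fin sl mulrA -{1}[m]mul1r ltr_pM2r// ltr_pdivlMr// mul1r.
  apply: ge_sume_seq_cst => y /lB; rewrite /B ball_mdistE => x0y.
  rewrite EFinM lee_pdivrMl// -muE; apply: hA; lra.
move=> [l [sl lB lnet]].
apply: (@le_trans _ _ (\sum_(x <- l)
    \int[mu]_(y in ball x s) (`|f y - a| `^ q)%:E)%E).
  apply: integral_bigsetU_le => //.
  - by move=> x; exact: measurable_ball_mdist.
  - by move=> x; apply: measurable_oscillation_integrand; exact: intf.
  move=> y /lnet[x xl xy]; rewrite -bigcup_seq; exists x => //.
  by rewrite ball_mdistE.
pose mB' := fine (mu B).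
have muBE : mu B = mB'%:E by rewrite fineK// ge0_fin_numE.
apply: (@le_trans _ _ ((size l)%:R * (G * t `^ q * (A * mB')))%:E).
  apply: le_sume_seq_cst => x /lB; rewrite /B ball_mdistE => x0x.
  apply: (@le_trans _ _ ((G * t `^ q)%:E * mu (ball x s))%E).
    (* On a small ball the bound about its own average holds with [H = 1]; [avg_chain] places [a]
       within [K * t] of that average. *)
    apply: (integral_recenter_le mu (ball x s) f
      (average mu f (ball x s))) => //.
    - exact: measurable_ball_mdist.
    - exact: mu_ball_fin.
    - exact: intf.
    - rewrite mul1r -le_oscillation ?(ltW t0)//.
      by apply: osc => //; exact: ltW.
    by apply: avg_chain; rewrite metric_sym; lra.
  rewrite [leRHS]EFinM lee_wpmul2l//.
    by rewrite lee_fin (mulr_ge0 G0)// powR_ge0.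
  (* [ball x s] is compared with [B] through [ball x0 (2 * b)], which contains it, and
     [ball x0 (s / 2)], which lies in [B]. *)
  apply: (le_trans (ball_le x0 x s (2 * b) _)); first by lra.
  apply: (le_trans (hA x0 x0 _)); first by rewrite mdistxx ltW.
  rewrite EFinM -muBE lee_wpmul2l ?lee_fin//; apply: ball_le.
  by rewrite mdistxx /s; lra.
rewrite muBE -EFinM lee_fin /H.
rewrite (_ : N%:R * G * A * t `^ q * mB' = N%:R * (G * t `^ q * (A * mB'))); last by ring.
rewrite ler_wpM2r ?ler_nat ?(ltnW sl)//.
have mB'0 : 0 <= mB' by rewrite fine_ge0.
by rewrite (mulr_ge0 (mulr_ge0 G0 (powR_ge0 _ _)))// mulr_ge0.
Qed.

End metric_measure.

(** * Equality of the spaces and equivalence of the norms *)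

Theorem proposition5p1 (R : realType) (d : measure_display)
  (M : measurableMetricType d R)
  (mu : {measure set M -> \bar R})
  (borel_M : @measurable d M = <<s @open M >>)
  (unbounded_M : ~ metric_bounded [set: M])
  (mu_pos : (0 < mu [set: M])%E)
  (mu_ball_fin : forall (x : M) (r : R), 0 < r -> (mu (ball x r) < +oo)%E)
  (LDP : locally_doubling mu)
  (isop : isoperimetric mu)
  (R0 beta : R) (R0_ge0 : 0 <= R0) (beta_gt : 1 / 2 < beta) (beta_lt : beta < 1)
  (AMP : approximate_midpoint M R0 beta)
  (q : R) (q_ge1 : 1 <= q)
  (b c : R) (b_gt0 : 0 < b) (c_gt0 : 0 < c)
  (R0_lt_c : R0 / (1 - beta) < c) (c_lt_b : c < b) :
  BMO mu q b = BMO mu q c /\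
  exists C1 C2 : R, [/\ 0 < C1, 0 < C2 &
    forall F : set (M -> R), BMO mu q b F -> forall f : M -> R, F f ->
      (C1%:E * BMO_norm mu q c f <= BMO_norm mu q b f)%E /\
      (BMO_norm mu q b f <= C2%:E * BMO_norm mu q c f)%E].

Proof.
have beta0 : 0 < beta by lra.
have R0c : R0 <= c / 2.
  move: R0_lt_c; rewrite ltr_pdivrMr ?subr_gt0// => R0c.
  have : c * (1 - beta) <= c / 2 by nra.
  by move=> cb; exact: ltW (lt_le_trans R0c cb).
have [C C0 hC] := BMO_norm_le_scale mu borel_M LDP mu_pos mu_ball_fin _ _ _ _ _
  AMP beta0 beta_lt q_ge1 c_gt0 c_lt_b R0c.
have cb_norm f : (BMO_norm mu q c f <= BMO_norm mu q b f)%E.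
  apply: ereal_sup_le => _ [B [x [r [r0 rc ->]]] <-].
  exists (ball x r) => //; exists x, r; split => //.
  exact: le_trans rc (ltW c_lt_b).
have norm_ge0 f : (0 <= BMO_norm mu q c f)%E.
  (* A point is required: over an empty family of balls the supremum would be [-oo]. *)
  have [x _] : [set: M] !=set0.
    apply/set0P/eqP => M0; move: mu_pos.
    by rewrite M0 measure0 ltxx.
  apply: (@le_trans _ _ (oscillation mu q f (ball x c))).
    exact: poweR_ge0.
  by apply: ereal_sup_ubound; exists (ball x c) => //; exists x, c.
have bc_norm f : ball_integrable mu f ->
    (BMO_norm mu q b f <= C%:E * BMO_norm mu q c f)%E.
  move=> intf; have := hC f intf; have := norm_ge0 f.
  case: (BMO_norm mu q c f) => [u| |]//; last first.
    by move=> _ _; rewrite gt0_muley ?lte_fin// leey.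
  (* [h] accepts only positive bounds, so it is applied to [u + e / C] with [e] arbitrarily small;
     this covers [u = 0]. *)
  rewrite lee_fin => u0 h; apply/lee_addgt0Pr => e e0.
  have ue : 0 < u + e / C by rewrite ltr_wpDl// divr_gt0.
  apply: (le_trans (h _ ue _)); first by rewrite lee_fin lerDl divr_ge0// ltW.
  by rewrite -EFinM -EFinD lee_fin mulrDr mulrCA mulfV ?mulr1// gt_eqF.
split.
  rewrite /BMO; congr image; apply/seteqP; split => f /= [intf fin]; split => //.
    exact: le_lt_trans fin.
  apply: le_lt_trans (bc_norm f intf) _.
  move: fin (norm_ge0 f); case: (BMO_norm mu q c f) => [u| |]// _ _.
  by rewrite -EFinM ltry.
(* Every member of a class is ball-integrable by [class_mod_constants], so [bc_norm] applies to it
   directly. *)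
exists 1, C; split => // F [g _ <-] f [intf _].
by rewrite mul1e; split => //; exact: bc_norm.
Qed.
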